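(* Let $d\ge 1$, $\boldsymbol{\alpha}\in\mathbb{N}_0^d$, let $N_F,N_V$ be positive integers and let $C_*>0$. There is a constant $C>0$, depending only on $N_F,N_V,C_*,\boldsymbol{\alpha}$ and $d$, such that for every simple, non-degenerate, convex $d$-dimensional polytope $K\subset\mathbb{R}^d$ with facet set $F$ and vertex set $V$ satisfying $|F|\le N_F$, $|V|\le N_V$ and $h_*\ge C_*h_K$, the Wachspress coordinates $\phi_{\boldsymbol{v}}$ of $K$ satisfy $$\left|D^{\boldsymbol{\alpha}}\phi_{\boldsymbol{v}}(\boldsymbol{x})\right|\le C\,h_K^{-|\boldsymbol{\alpha}|}\qquad\text{for all }\boldsymbol{v}\in V,\ \boldsymbol{x}\in K.$$
   Context: Polytopes: a $d$-dimensional convex polytope $K\subset\mathbb{R}^d$ is the convex hull of finitely many points whose affine hull is $\mathbb{R}^d$. Faces are intersections of $K$ with supporting hyperplanes; vertices are the $0$-dimensional faces and facets the $(d-1)$-dimensional faces. $V$ and $F$ are the sets of vertices and facets; $|V|,|F|$ are their cardinalities. For $f\in F$, $V_f$ is the set of vertices contained in $f$; for $\boldsymbol{v}\in V$, $F_{\boldsymbol{v}}$ is the set of facets containing $\boldsymbol{v}$. Non-degenerate: adjacent facets do not lie in the same hyperplane. Simple: $|F_{\boldsymbol{v}}|=d$ for all $\boldsymbol{v}\in V$. Sizes: $h_K$ is the diameter of $K$. For $\boldsymbol{x}\in K$ and $f\in F$, $h_f(\boldsymbol{x})$ is the distance from $\boldsymbol{x}$ to the hyperplane containing $f$; $h_f(\boldsymbol{x})=(\boldsymbol{v}-\boldsymbol{x})\cdot\boldsymbol{n}_f$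 for any $\boldsymbol{v}\in V_f$, where $\boldsymbol{n}_f$ is the unit outward normal of $f$. $h_*=\min_{f\in F}\min_{\boldsymbol{v}\in V\setminus V_f}h_f(\boldsymbol{v})$. Wachspress coordinates: for $\boldsymbol{v}\in V$ with $F_{\boldsymbol{v}}=\{f_1,\dots,f_d\}$, let $M_{\boldsymbol{v}}=[\boldsymbol{n}_{f_1},\dots,\boldsymbol{n}_{f_d}]\in\mathbb{R}^{d\times d}$, with the facets ordered so that $\det(M_{\boldsymbol{v}})>0$. Set $w_{\boldsymbol{v}}(\boldsymbol{x})=\det(M_{\boldsymbol{v}})\prod_{f\in F\setminus F_{\boldsymbol{v}}}h_f(\boldsymbol{x})$, $W=\sum_{\boldsymbol{u}\in V}w_{\boldsymbol{u}}$, and $\phi_{\boldsymbol{v}}=w_{\boldsymbol{v}}/W$ on $K$ (here $W>0$ on $K$). Derivatives at points of $K$, including boundary points, are those of the rational function $w_{\boldsymbol{v}}/W$ (with each $h_f$ regarded as an affine polynomial). Multi-indices: $|\boldsymbol{\alpha}|=\sum_i\alpha_i$ and $D^{\boldsymbol{\alpha}}=\partial^{|\boldsymbol{\alpha}|}/\partial x_1^{\alpha_1}\cdots\partial x_d^{\alpha_d}$. *)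

(* Defs.v *)
From HB Require Import structures.
From mathcomp Require Import all_boot all_order all_algebra.
From mathcomp Require Import finmap.
From mathcomp Require Import all_classical all_reals all_analysis.
Import Order.TTheory GRing.Theory Num.Theory.
Import numFieldNormedType.Exports.

Set Implicit Arguments.
Unset Strict Implicit.
Unset Printing Implicit Defensive.

Local Open Scope classical_set_scope.
Local Open Scope ring_scope.

Section Polytopes.
Context {R : realType} {d : nat}.
Local Notation E := 'rV[R]_d.
Implicit Types (A K f g : set E) (u v x y n : E).

Definition dot x y : R := \sum_(i < d) x ord0 i * y ord0 i.

(* The library's norm on row vectors is the sup norm, hence this one. *)
Definition enorm x : R := Num.sqrt (dot x x).

Definition affine_hull A : set E :=
  [set x | exists (m : nat) (a : 'I_m -> R) (p : 'I_m -> E),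
    [/\ forall i, A (p i), \sum_(i < m) a i = 1
      & x = \sum_(i < m) a i *: p i]].

Definition convex_hull A : set E :=
  [set x | exists (m : nat) (a : 'I_m -> R) (p : 'I_m -> E),
    [/\ forall i, A (p i), forall i, 0 <= a i, \sum_(i < m) a i = 1
      & x = \sum_(i < m) a i *: p i]].

Definition affine_dim A (k : nat) : Prop :=
  exists (x0 : E) (U : {vspace E}),
    [/\ A x0, \dim U = k & affine_hull A = [set x | x - x0 \in U]].

Definition polytope K : Prop :=
  exists A, [/\ finite_set A, affine_hull A = setT & K = convex_hull A].

Definition hyperplane n (c : R) : set E := [set x | dot x n = c].

Definition supporting K n (c : R) : Prop :=
  [/\ n != 0, K `<=` [set x | dot x n <= c] & K `&` hyperplane n c !=set0].

Definition face K f : Prop :=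
  exists (n : E) (c : R), supporting K n c /\ f = K `&` hyperplane n c.

Definition vertices K : set E := [set v | face K [set v]].

(* dimension d - 1, written so as to avoid truncated subtraction *)
Definition facets K : set (set E) :=
  [set f | face K f /\ exists2 k : nat, affine_dim f k & k.+1 = d].

Definition vertices_of K f : set E := vertices K `&` f.

Definition facets_at K v : set (set E) := [set f | facets K f /\ f v].

Definition simple_polytope K : Prop :=
  forall v, vertices K v -> (facets_at K v #= `I_d)%card.

(* Two facets are adjacent when they meet in a set of dimension d - 2. *)
Definition adjacent_facets f g : Prop :=
  f <> g /\ exists2 k : nat, affine_dim (f `&` g) k & k.+2 = d.

(* Automatic when facets are the (d - 1)-dimensional faces. *)
Definition non_degenerate K : Prop :=
  forall f g, facets K f -> facets K g -> adjacent_facets f g ->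
    ~ exists (n : E) (c : R),
        [/\ n != 0, f `<=` hyperplane n c & g `<=` hyperplane n c].

Definition diameter K : R := sup [set enorm (x - y) | x in K & y in K].

(* For a facet f of a polytope K there is exactly one such n: maximality at
   every point of f makes n constant on f, and n points away from K. *)
Definition is_unit_outward_normal K f n : Prop :=
  enorm n = 1 /\ forall y x, f y -> K x -> dot x n <= dot y n.

Definition outward_normal K f : E := xget 0 [set n | is_unit_outward_normal K f n].

(* The distance from x to the hyperplane containing f when x is in K, extended
   to all of R^d as an affine function; it does not depend on the vertex of f
   that is picked. *)
Definition facet_dist K f x : R :=
  dot (xget 0 (vertices_of K f) - x) (outward_normal K f).

(* The set is finite and nonempty, so that its infimum is a minimum. *)
Definition hstar K : R :=
  inf [set r | exists f v, [/\ facets K f, (vertices K `\` vertices_of K f) v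
                             & r = facet_dist K f v]].

(* The columns are the unit outward normals of the facets at v, in the order
   in which fset_set enumerates them. *)
Definition normal_mx K v : 'M[R]_d :=
  \matrix_(i, j) outward_normal K (nth set0 (fset_set (facets_at K v)) j) ord0 i.

(* The absolute value is the determinant for an ordering of the facets at v
   that makes it positive. Such an ordering exists for d >= 2; for d = 1 there
   is a single ordering, whose determinant is -1 at the left end point, and the
   absolute value is what makes the sum of the weights positive. *)
Definition weight K v x : R :=
  `|\det (normal_mx K v)| *
  \prod_(f <- fset_set (facets K `\` facets_at K v)) facet_dist K f x.

Definition total_weight K x : R :=
  \sum_(u <- fset_set (vertices K)) weight K u x.

(* A rational function on R^d, whose denominator is positive near K; its
   derivatives at points of K are those of the rational function. *)
Definition wachspress K v x : R := weight K v x / total_weight K x.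

Definition partial (i : 'I_d) (F : E -> R) : E -> R :=
  fun x => 'D_(delta_mx ord0 i) F x.

Definition mder (alpha : 'I_d -> nat) (F : E -> R) : E -> R :=
  foldr (fun i G => iter (alpha i) (partial i) G) F (enum 'I_d).

Definition mabs (alpha : 'I_d -> nat) : nat := (\sum_(i < d) alpha i)%N.

End Polytopes.

(* Main.v *)
Require Import Defs.
From mathcomp Require Import all_boot all_order all_algebra perm finmap.
From mathcomp Require Import all_classical all_reals all_analysis.
From mathcomp Require Import ring lra.
Import Order.TTheory GRing.Theory Num.Theory.
Import numFieldNormedType.Exports.

(* Write [h] for the lower bound [Cstar * diameter K] of [hstar K].  At a vertex
   [v], the facets through [v] cut out the tangent cone of [K], so for each facet
   at [v] there is a vertex lying on all the other facets at [v] but not on this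
   one.  The matrix of the [d] edge vectors so obtained, times [normal_mx K v], is
   diagonal with entries at least [h]; hence [|det|] is bounded below by
   [Cstar ^ d / d!].  A point [x] of [K] is a convex combination of vertices,
   and the vertices off a facet close to [x] carry little of its mass: some vertex
   therefore lies on every facet at distance less than [h / (NF + 1)] from [x],
   and its weight bounds the total weight from below.  Every vertex has
   [|F| - d] factors in its weight, so after scaling distances by the diameter
   the Wachspress coordinate is a quotient of functions whose derivatives are all
   controlled, with denominator bounded below. *)

Set Implicit Arguments.
Unset Strict Implicit.
Unset Printing Implicit Defensive.

Local Open Scope classical_set_scope.
Local Open Scope ring_scope.

(** * Farkas' lemma and facet directions of a cone *)

Section Dot.
Context {R : realType} {d : nat}.
Implicit Types x y z n : 'rV[R]_d.

Lemma dotC x y : dot x y = dot y x.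
Proof. by apply: eq_bigr => i _; rewrite mulrC. Qed.

Lemma dotDl x y z : dot (x + y) z = dot x z + dot y z.
Proof. by rewrite -big_split; apply: eq_bigr => i _; rewrite mxE mulrDl. Qed.

Lemma dotZl a x z : dot (a *: x) z = a * dot x z.
Proof. by rewrite mulr_sumr; apply: eq_bigr => i _; rewrite mxE mulrA. Qed.

Lemma dotNl x z : dot (- x) z = - dot x z.
Proof. by rewrite -scaleN1r dotZl mulN1r. Qed.

Lemma dotBl x y z : dot (x - y) z = dot x z - dot y z.
Proof. by rewrite dotDl dotNl. Qed.

Lemma dot0l z : dot 0 z = 0.
Proof. by rewrite -(subrr z) dotBl subrr. Qed.

Lemma dotDr z x y : dot z (x + y) = dot z x + dot z y.
Proof. by rewrite !(dotC z) dotDl. Qed.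

Lemma dotZr a z x : dot z (a *: x) = a * dot z x.
Proof. by rewrite !(dotC z) dotZl. Qed.

Lemma dotNr z x : dot z (- x) = - dot z x.
Proof. by rewrite !(dotC z) dotNl. Qed.

Lemma dotBr z x y : dot z (x - y) = dot z x - dot z y.
Proof. by rewrite !(dotC z) dotBl. Qed.

Lemma dot0r z : dot z 0 = 0.
Proof. by rewrite dotC dot0l. Qed.

Lemma dot_suml (I : Type) (r : seq I) (P : pred I) (F : I -> 'rV[R]_d) z :
  dot (\sum_(i <- r | P i) F i) z = \sum_(i <- r | P i) dot (F i) z.
Proof.
by elim/big_rec2 : _ => [|i s t _ <-]; [exact: dot0l | rewrite dotDl].
Qed.

Lemma dot_ge0 x : 0 <= dot x x.
Proof. by apply: sumr_ge0 => i _; rewrite -expr2 sqr_ge0. Qed.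

Lemma dot_eq0 x : dot x x = 0 -> x = 0.
Proof.
move=> x0; apply/rowP => i; rewrite mxE.
have : x ord0 i * x ord0 i == 0.
  rewrite eq_le -expr2 sqr_ge0 andbT -x0 expr2.
  by rewrite /dot (bigD1 i)//= lerDl sumr_ge0// => j _; rewrite -expr2 sqr_ge0.
by rewrite mulf_eq0 orbb => /eqP.
Qed.

Lemma dot_gt0 x : x != 0 -> 0 < dot x x.
Proof.
by rewrite lt_def dot_ge0 andbT; apply: contra => /eqP /dot_eq0 ->.
Qed.

Lemma dot_deltar x i : dot x (delta_mx ord0 i) = x ord0 i.
Proof.
rewrite /dot (bigD1 i)//= big1 => [|j ji]; rewrite mxE !eqxx.
  by rewrite mulr1 addr0.
by rewrite (negPf ji) mulr0.
Qed.

Lemma enorm_ge0 x : 0 <= enorm x.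
Proof. exact: sqrtr_ge0. Qed.

Lemma enorm_sqr x : enorm x ^+ 2 = dot x x.
Proof. exact/sqr_sqrtr/dot_ge0. Qed.

Lemma coord_le_enorm x i : `|x ord0 i| <= enorm x.
Proof.
rewrite -(@ler_pXn2r _ 2)// ?nnegrE ?enorm_ge0// enorm_sqr real_normK ?num_real//.
rewrite /dot (bigD1 i)//= expr2 lerDl.
by rewrite sumr_ge0// => j _; rewrite -expr2 sqr_ge0.
Qed.

Lemma dot_unit_le x n : enorm n = 1 -> `|dot x n| <= enorm x.
Proof.
move=> n1; have nn : dot n n = 1 by rewrite -enorm_sqr n1 expr1n.
rewrite -(@ler_pXn2r _ 2)// ?nnegrE ?enorm_ge0// enorm_sqr real_normK ?num_real//.
have := dot_ge0 (x - dot x n *: n).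
rewrite !(dotBl, dotBr, dotZl, dotZr) nn (dotC n x).
by set a := dot x n; set b := dot x x => ?; nra.
Qed.

End Dot.

(** * Farkas' lemma and strict separation from a finite convex hull *)

Section Farkas.
Context {R : realType}.

(* Bartl's induction on the number of inequalities: if dropping [a m] breaks
   the implication at [z], project along [z] onto the kernel of [a m]. *)
Lemma farkas (d : nat) (I : finType) (S : {set I}) (a : I -> 'rV[R]_d) (b : 'rV[R]_d) :
  (forall y, (forall i, i \in S -> dot (a i) y <= 0) -> dot b y <= 0) ->
  exists l : I -> R, (forall i, 0 <= l i) /\ b = \sum_(i in S) l i *: a i.
Proof.
elim: {S}_.+1 {-2}S (ltnSn #|S|) a b => // k IH S Sk a b ab.
have [S0|[m mS]] := set_0Vmem S.
  exists (fun=> 0); split=> //; rewrite S0 big_set0.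
  by apply/dot_eq0/eqP; rewrite eq_le dot_ge0 andbT ab// => i; rewrite S0 inE.
have Smk : (#|S :\ m| < k)%N by move: Sk; rewrite (cardsD1 m) mS.
have [H|/existsNP[z /not_implyP[az /negP]]] :=
  pselect (forall y, (forall i, i \in S :\ m -> dot (a i) y <= 0) -> dot b y <= 0).
  have [l [l0 ->]] := IH _ Smk a b H.
  exists (fun i => if i == m then 0 else l i); split=> [i|]; first by case: ifP.
  rewrite [RHS](big_setD1 m)//= eqxx scale0r add0r.
  by apply: eq_bigr => i; rewrite !inE => /andP[/negPf ->].
rewrite -ltNge => bz.
have mz : 0 < dot (a m) z.
  rewrite ltNge; apply: contraPN bz => mz; apply/negP; rewrite -leNgt.
  apply: ab => i iS; have [->//|im] := eqVneq i m.
  by apply: az; rewrite !inE im.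
pose c i := dot (a i) z / dot (a m) z.
pose cb := dot b z / dot (a m) z.
have := IH _ Smk (fun i => a i - c i *: a m) (b - cb *: a m).
(* [y'] is the projection of [y] along [z] onto the kernel of [a m]; testing the modified vectors on
   [y] is testing the original ones on [y'], where the constraint [m] is an equality. *)
case=> [y ay|l [l0 lb]].
  set y' := y - (dot (a m) y / dot (a m) z) *: z.
  have -> : dot (b - cb *: a m) y = dot b y'.
    by rewrite /y' /cb dotBl dotZl dotBr dotZr; field; rewrite gt_eqF.
  apply: ab => i iS; have [->|im] := eqVneq i m.
    by rewrite /y' dotBr dotZr divfK ?gt_eqF// subrr.
  have := ay i; rewrite !inE im iS => /(_ isT).
  suff -> : dot (a i - c i *: a m) y = dot (a i) y' by [].
  by rewrite /y' /c dotBl dotZl dotBr dotZr; field; rewrite gt_eqF.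
(* This is the coefficient that [a m] receives when the projection is undone. It is nonnegative
   because [z] is positive on [b] and [a m], and nonpositive on the other [a i]. *)
have cb0 : 0 <= cb - \sum_(i in S :\ m) l i * c i.
  rewrite subr_ge0 (@le_trans _ _ 0)//; last by rewrite divr_ge0 ?ltW.
  apply: sumr_le0 => i iS; rewrite mulr_ge0_le0//.
  by rewrite /c mulr_le0_ge0 ?invr_ge0 ?(ltW mz)// az.
exists (fun i => if i == m then cb - \sum_(i in S :\ m) l i * c i else l i).
split=> [i|]; first by case: ifP.
rewrite [RHS](big_setD1 m)//= eqxx.
under [X in _ + X]eq_bigr => i.
  by rewrite !inE => /andP[/negPf -> _]; over.
have -> : b = \sum_(i in S :\ m) l i *: (a i - c i *: a m) + cb *: a m.
  by rewrite -lb subrK.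
under [X in X + _]eq_bigr do rewrite scalerBr scalerA.
by rewrite sumrB -scaler_suml scalerBl -addrA [LHS]addrC [- _ + _]addrC.
Qed.

(** Homogenization: with an extra coordinate equal to 1, convex combinations become conic ones, and
    that coordinate of Farkas' identity says that the coefficients sum to 1. When Farkas fails, the
    contribution of the extra coordinate cancels between [p i] and [b]. *)
Lemma separation (d : nat) (I : finType) (S : {set I}) (p : I -> 'rV[R]_d) (b : 'rV[R]_d) :
  ~ (exists l : I -> R, [/\ forall i, 0 <= l i, \sum_(i in S) l i = 1
        & b = \sum_(i in S) l i *: p i]) ->
  exists n, forall i, i \in S -> dot (p i) n < dot b n.
Proof.
move=> nb; apply: contrapT => /forallNP H; apply: nb.
pose hom x : 'rV[R]_(d + 1) := row_mx x (const_mx 1).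
have homE x y : dot (hom x) y = dot x (lsubmx y) + rsubmx y ord0 ord0.
  rewrite /dot big_split_ord big_ord1 /=; congr (_ + _).
    by apply: eq_bigr => i _; rewrite row_mxEl mxE.
  by rewrite row_mxEr !mxE mul1r.
have [y py|l [l0 lb]] := @farkas _ I S (hom \o p) (hom b).
  rewrite leNgt; apply/negP => by0; apply: (H (lsubmx y)) => i /py/=.
  move=> h; have := le_lt_trans h by0; rewrite !homE; lra.
exists l; split=> //.
  have := congr1 (fun x : 'rV[R]_(d + 1) => x ord0 (rshift d ord0)) lb.
  rewrite row_mxEr mxE summxE => ->; apply: eq_bigr => i _.
  by rewrite mxE row_mxEr mxE mulr1.
have := congr1 (@lsubmx R 1 d 1) lb; rewrite row_mxKl => ->.
by rewrite linear_sum; apply: eq_bigr => i _; rewrite linearZ/= row_mxKl.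
Qed.

End Farkas.

(** * Facet directions of a finitely generated cone *)

Section FacetDirection.
Context {R : realType} {d : nat}.
Implicit Types (n b : 'rV[R]_d) (U : {vspace 'rV[R]_d}).

(** Farkas' lemma for a basis of [U] taken with both signs: the cone it generates stays in [U], so a
    vector [b] outside [U] is separated from it, by a direction necessarily orthogonal to [U]. *)
Lemma orthogonal_exists U : (\dim U < d)%N ->
  exists2 n, n != 0 & forall u, u \in U -> dot u n = 0.
Proof.
move=> Ud.
have [b bU] : exists b, b \notin U.
  apply: contrapT => /forallNP H; move: Ud.
  suff -> : U = fullv by rewrite dimvf dim_matrix mul1r ltnn.
  by apply/vspaceP => x; rewrite memvf; apply/negPn/negP; exact: H.
pose X := vbasis U.
pose a (i : 'I_(\dim U) * bool) := if i.2 then X`_i.1 else - X`_i.1.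
have [H|/existsNP[n /not_implyP[an /negP]]] := pselect (forall y,
    (forall i, i \in [set: _]%SET -> dot (a i) y <= 0) -> dot b y <= 0).
  have [l [_ lb]] := farkas H; case/negP: bU; rewrite lb.
  apply: rpred_sum => -[i []] _; rewrite /a/= ?rpredZ// ?rpredN;
  by apply/vbasis_mem/mem_nth; rewrite size_tuple.
rewrite -ltNge => bn; exists n.
  by apply: contraTneq bn => ->; rewrite dot0r ltxx.
move=> u /coord_vbasis ->; rewrite dot_suml big1 // => i _.
rewrite dotZl; suff -> : dot X`_i n = 0 by rewrite mulr0.
apply/eqP; rewrite eq_le (an (i, true))//=.
by have := an (i, false); rewrite /a/= dotNl oppr_le0 inE => ->.
Qed.

Variables (I : finType) (a : I -> 'rV[R]_d).

(** For [a i = p i - p i0] and [n] maximal at [p i0], this is the direction space of the face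
    exposed by [n]. *)
Definition tight_span n : {vspace 'rV[R]_d} :=
  <<[seq a i | i <- enum I & (dot (a i) n == 0)%R]>>%VS.

Lemma mem_tight_span n i : dot (a i) n = 0 -> a i \in tight_span n.
Proof.
by move=> ain; apply: memv_span; apply: map_f; rewrite mem_filter mem_enum ain eqxx.
Qed.

Lemma tight_span_sub n U : (forall i, dot (a i) n = 0 -> a i \in U) ->
  (tight_span n <= U)%VS.
Proof.
by move=> nU; apply/span_subvP => u /mapP[i]; rewrite mem_filter => /andP[/eqP/nU ? _ ->].
Qed.

Lemma tight_span_orth n m u :
  (forall i, dot (a i) n = 0 -> dot (a i) m = 0) ->
  u \in tight_span n -> dot u m = 0.
Proof.
move=> nm /(@coord_span _ _ _ (in_tuple _)) ->.
rewrite dot_suml big1// => j _; rewrite dotZl.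
have /mapP[i] := mem_nth 0 (ltn_ord j).
by rewrite mem_filter => /andP[/eqP ain _] ->; rewrite nm ?mulr0.
Qed.

Lemma dim_lt_orth U n : n != 0 -> (forall u, u \in U -> dot u n = 0) ->
  (\dim U < d)%N.
Proof.
move=> n0 Un; have nU : n \notin U.
  by apply: contra_neqN n0 => /Un /dot_eq0.
have dE : \dim (fullv : {vspace 'rV[R]_d}) = d by rewrite dimvf dim_matrix mul1r.
rewrite -[X in (_ < X)%N]dE ltn_neqAle dimvS ?subvf// andbT; apply: contra nU.
by rewrite (dimv_leqif_eq (subvf U)) => /eqP ->; rewrite memvf.
Qed.

(** Otherwise adding [x] to [U] would give a space of dimension [d] still orthogonal to [n]. *)
Lemma mem_hyperplane U n x : n != 0 -> (forall u, u \in U -> dot u n = 0) ->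
  (\dim U).+1 = d -> dot x n = 0 -> x \in U.
Proof.
move=> n0 Un Ud xn; apply: contrapT => /negP xU.
have : (\dim U < \dim (U + <[x]>))%N.
  rewrite ltn_neqAle dimvS ?addvSl// andbT (dimv_leqif_eq (addvSl U <[x]>)).
  by apply: contra xU => /eqP ->; exact: (subvP (addvSr _ _) _ (memv_line x)).
rewrite Ud leqNgt => /negP; apply.
apply: (@dim_lt_orth _ n) => // _ /memv_addP[u uU [_ /vlineP[k ->] ->]].
by rewrite dotDl dotZl xn Un// mulr0 addr0.
Qed.

(* Among the directions separating [b] from the cone spanned by the [a i], one
   whose tight vectors span a space of maximal dimension is a facet direction:
   otherwise it can be rotated, within the orthogonal of the tight vectors and
   of [b], until a new constraint becomes tight. *)
Lemma facet_direction b :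
  (forall n, (forall i, dot (a i) n = 0) -> n = 0) ->
  (exists2 n, forall i, dot (a i) n <= 0 & 0 < dot b n) ->
  exists n, [/\ forall i, dot (a i) n <= 0, 0 < dot b n
    & (\dim (tight_span n)).+1 = d].
Proof.
move=> aspan [n an bn].
have n_neq0 m : 0 < dot b m -> m != 0.
  by move=> bm; apply: contraTneq bm => ->; rewrite dot0r ltxx.
have dimn m : 0 < dot b m -> (\dim (tight_span m) < d)%N.
  by move=> /n_neq0 m0; apply: dim_lt_orth m0 _ => u; exact: tight_span_orth (fun _ => id).
have [k] := ubnP (d - \dim (tight_span n))%N.
elim: k => // k IH in n an bn *; rewrite ltnS => dk.
have [nd|nd] := leqP d (\dim (tight_span n)).+1.
  by exists n; split=> //; apply/eqP; rewrite eqn_leq nd andbT dimn.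
have [|c c0 cU] := @orthogonal_exists (tight_span n + <[b]>).
  apply: leq_ltn_trans (dimv_add_leqif _ _) _.
  by apply: leq_ltn_trans nd; rewrite dim_vline addnC; case: (b != 0).
(* Up to replacing [c] by its opposite: if neither sign worked, [c] would be orthogonal to every
   [a i], hence zero. *)
wlog [i0 i0c] : c c0 cU / exists i, 0 < dot (a i) c.
  move=> H; have [/existsP[i ic]|/existsPn aic] := boolP [exists i, 0 < dot (a i) c].
    by apply: (H c) => //; exists i.
  apply: (H (- c)); first by rewrite oppr_eq0.
    by move=> u /cU uc; rewrite dotNr uc oppr0.
  apply: contrapT => /forallNP aic'; move/eqP: c0; apply; apply: aspan => i.
  apply/eqP; rewrite eq_le leNgt aic/=.
  by have := aic' i; rewrite dotNr oppr_gt0 => /negP; rewrite -leNgt.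
have bc : dot b c = 0 by apply: cU; exact: (subvP (addvSr _ _) _ (memv_line b)).
have tc u : u \in tight_span n -> dot u c = 0.
  by move=> un; apply: cU; exact: (subvP (addvSl _ _)).
have tight_ratio i : dot (a i) n = 0 -> dot (a i) c = 0.
  by move=> /mem_tight_span /tc.
(* [r i] is the time at which the constraint [i] becomes tight along [n + t *: c]; the least one
   over the growing constraints is the longest admissible move. *)
pose r i := - dot (a i) n / dot (a i) c.
have [j jc jmin] := @arg_minP _ _ _ i0 (fun i => 0 < dot (a i) c) r i0c.
have rj0 : 0 <= r j by rewrite divr_ge0 ?(ltW jc)// oppr_ge0.
pose n' := n + r j *: c.
have an' i : dot (a i) n' <= 0.
  rewrite dotDr dotZr; have [ic|ic] := ltP 0 (dot (a i) c).
    have := jmin i ic; rewrite {2}/r ler_pdivlMr//; lra.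
  by rewrite -[leRHS]addr0 lerD// mulr_ge0_le0.
have bn' : 0 < dot b n' by rewrite dotDr dotZr bc mulr0 addr0.
apply: (IH n') => //; apply: leq_trans dk.
suff : (\dim (tight_span n) < \dim (tight_span n'))%N.
  by move=> lt_dim; rewrite ltn_sub2l// dimn.
have sub : (tight_span n <= tight_span n')%VS.
  apply: tight_span_sub => i ain; apply: mem_tight_span.
  by rewrite dotDr dotZr ain tight_ratio// mulr0 addr0.
rewrite ltn_neqAle dimvS// andbT (dimv_leqif_eq sub).
(* The dimension grows strictly: [a j] is now tight, but it is not orthogonal to [c], unlike the old
   span. *)
apply: contraTneq (jc) => eq_span; rewrite tc ?ltxx// eq_span.
by apply: mem_tight_span; rewrite dotDr dotZr /r divfK ?subrr // gt_eqF.
Qed.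

End FacetDirection.

(** * Polytopes as convex hulls of their vertices *)

Section Hull.
Context {R : realType} {d : nat}.
Local Notation E := 'rV[R]_d.
Implicit Types (K f : set E) (x y n : E).

Definition hull (I : finType) (S : {set I}) (p : I -> E) : set E :=
  [set x | exists l : I -> R, [/\ forall i, 0 <= l i, \sum_(i in S) l i = 1
    & x = \sum_(i in S) l i *: p i]].

(** Dual form of the generators having full affine hull. For [0 < d] it also rules out an empty
    family. *)
Definition affinely_spanning (I : finType) (p : I -> E) : Prop :=
  forall n c, (forall i, dot (p i) n = c) -> n = 0.

Lemma sub_dot_comb (I : finType) (S : {set I}) (p : I -> E) l n c :
  \sum_(i in S) l i = 1 ->
  c - dot (\sum_(i in S) l i *: p i) n = \sum_(i in S) l i * (c - dot (p i) n).
Proof.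
move=> l1; under [RHS]eq_bigr do rewrite mulrBr.
rewrite sumrB -mulr_suml l1 mul1r dot_suml; congr (_ - _).
by apply: eq_bigr => i _; rewrite dotZl.
Qed.

Lemma mem_hull (I : finType) (S : {set I}) (p : I -> E) i : i \in S -> hull S p (p i).
Proof.
move=> iS; exists (fun j => (j == i)%:R); split=> //.
  rewrite (big_setD1 i)//= eqxx big1 ?addr0// => j.
  by rewrite !inE => /andP[/negPf ->].
rewrite (big_setD1 i)//= eqxx scale1r big1 ?addr0// => j.
by rewrite !inE => /andP[/negPf ->]; rewrite scale0r.
Qed.

Lemma hull_dot_le (I : finType) (S : {set I}) (p : I -> E) n c x :
  hull S p x -> (forall i, i \in S -> dot (p i) n <= c) -> dot x n <= c.
Proof.
move=> [l [l0 l1 ->]] pc; rewrite -subr_ge0 sub_dot_comb//.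
by apply: sumr_ge0 => i /pc ?; rewrite mulr_ge0// subr_ge0.
Qed.

Lemma hull_dot_eq (I : finType) (S : {set I}) (p : I -> E) n c x :
  hull S p x -> (forall i, i \in S -> dot (p i) n = c) -> dot x n = c.
Proof.
move=> [l [l0 l1 ->]] pc; apply/eqP; rewrite eq_sym -subr_eq0 sub_dot_comb//.
by rewrite big1// => i /pc ->; rewrite subrr mulr0.
Qed.

(** The slacks [c - dot (p i) n] are nonnegative and their weighted average is zero, so each
    weighted slack vanishes. *)
Lemma comb_support (I : finType) (S : {set I}) (p : I -> E) l n c :
  (forall i, 0 <= l i) -> \sum_(i in S) l i = 1 ->
  (forall i, i \in S -> dot (p i) n <= c) ->
  dot (\sum_(i in S) l i *: p i) n = c ->
  forall i, i \in S -> l i = 0 \/ dot (p i) n = c.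
Proof.
move=> l0 l1 pc xc i iS; have /eqP := sub_dot_comb p n c l1.
rewrite xc subrr eq_sym psumr_eq0 => [/allP/(_ i (mem_index_enum _))|j /pc ?].
  rewrite iS mulf_eq0 subr_eq0 => /orP[] /eqP; [by left | by right].
by rewrite mulr_ge0// subr_ge0.
Qed.

(** Take a generating subset of least cardinality: a generator in the hull of the others could be
    substituted away. *)
Lemma hull_minimal (I : finType) (p : I -> E) : exists S : {set I},
  hull S p = hull [set: I] p /\ forall i, i \in S -> ~ hull (S :\ i) p (p i).
Proof.
have [|S] := @arg_minP _ _ _ [set: I]%SET
  (fun S => `[< hull [set: I] p `<=` hull S p >]) (fun S => #|S|).
  by apply/asboolP.
move=> /asboolP TS Smin; exists S; split.
  apply/seteqP; split=> // x [l [l0 l1 ->]].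
  exists (fun i => if i \in S then l i else 0); split=> [i||].
  - by case: ifP.
  - rewrite -[RHS]l1 [LHS](big_setID S)/= finset.setTI [X in _ + X]big1 ?addr0.
      by apply: eq_bigr => i ->.
    by move=> i; rewrite !inE andbT => /negPf ->.
  - rewrite [RHS](big_setID S)/= finset.setTI [X in _ + X]big1 ?addr0.
      by apply: eq_bigr => i ->.
    by move=> i; rewrite !inE andbT => /negPf ->; rewrite scale0r.
move=> i iS [m [m0 m1 pim]].
have : (#|S| <= #|S :\ i|)%N.
  apply: Smin; apply/asboolP => x /TS[l [l0 l1 ->]].
  exists (fun j => l j + l i * m j); split=> [j||].
  - by rewrite addr_ge0// mulr_ge0.
  - by rewrite big_split/= -mulr_sumr m1 mulr1 addrC -(big_setD1 i).
  - rewrite (big_setD1 i)//= {1}pim scaler_sumr addrC -big_split/=.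
    by apply: eq_bigr => j _; rewrite scalerDl scalerA.
by rewrite (cardsD1 i S) iS ltnn.
Qed.

Lemma hull_enum_val (I : finType) (S : {set I}) (p : I -> E) i0 : i0 \in S ->
  hull [set: 'I_#|S|] (p \o enum_val) = hull S p.
Proof.
move=> i0S; apply/seteqP; split=> x [l [l0 l1 ->]]; last first.
  exists (l \o enum_val); split=> [i||]; first exact: l0.
    by rewrite -l1 [RHS]big_enum_val; apply: eq_bigl => i; rewrite inE.
  by rewrite [LHS]big_enum_val; apply: eq_bigl => i; rewrite inE.
exists (l \o enum_rank_in i0S); split=> [i||]; first exact: l0.
  rewrite big_enum_val -l1; apply: eq_big => i; rewrite ?inE// => _.
  by rewrite /= enum_valK_in.
rewrite [RHS]big_enum_val; apply: eq_big => i; rewrite ?inE// => _.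
by rewrite /= enum_valK_in.
Qed.

Lemma polytope_hull K : polytope K -> exists (I : finType) (p : I -> E),
  K = hull [set: I] p /\ affinely_spanning p.
Proof.
move=> [A [/finite_fsetP[X ->] AT ->]].
exists X, val; split; last first.
  move=> n c pc.
  have dc x : dot x n = c.
    have : affine_hull [set` X] x by rewrite AT.
    move=> [m [a [q [qX a1 ->]]]]; rewrite dot_suml.
    rewrite -[RHS]mul1r -a1 mulr_suml; apply: eq_bigr => i _.
    by rewrite dotZl (pc [` qX i]%fset).
  by apply: dot_eq0; rewrite dc -(dc 0) dot0l.
apply/seteqP; split=> x; last first.
  move=> [l [l0 l1 ->]].
  exists #|[set: X]%SET|, (l \o enum_val), (val \o enum_val); split=> [i|i||].
  - exact: (fsvalP (enum_val i)).
  - exact: l0.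
  - by rewrite -[RHS]l1 [RHS]big_enum_val.
  - by rewrite [LHS]big_enum_val.
(* The points [q j] may repeat, so the coefficients of equal points are added up. *)
move=> [m [a [q [qX a0 a1 ->]]]]; pose g j : X := [` qX j]%fset.
exists (fun i => \sum_(j | g j == i) a j); split=> [i||].
- exact: sumr_ge0.
- by rewrite -a1 [RHS](partition_big g (mem [set: X]%SET))//= => i _; rewrite inE.
- rewrite (partition_big g (mem [set: X]%SET))/= => [|i _]; last by rewrite inE.
  apply: eq_bigr => i _; rewrite scaler_suml; apply: eq_bigr => j /eqP <-//.
Qed.

(** In a minimal generating family each generator is strictly separated from the hull of the others,
    and the separating functional exposes it as a vertex. *)
Lemma polytope_hull_vertices K : (0 < d)%N -> polytope K ->
  exists (I : finType) (p : I -> E),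
  [/\ K = hull [set: I] p, affinely_spanning p & forall i, vertices K (p i)].
Proof.
move=> d0 /polytope_hull[I [p [KE pspan]]].
have [S [SE Smin]] := hull_minimal p.
pose e0 : E := delta_mx ord0 (Ordinal d0).
have e0_neq0 : e0 != 0.
  by apply/eqP => /rowP/(_ (Ordinal d0)) /eqP; rewrite !mxE !eqxx oner_eq0.
have [i0 i0S] : exists i, i \in S.
  have [S0|[i iS]] := set_0Vmem S; last by exists i.
  case/negP: e0_neq0; apply/eqP; apply: (pspan _ 0) => i.
  have : hull S p (p i) by rewrite SE; exact: mem_hull.
  by case=> l [_ + _]; rewrite S0 big_set0 => /esym/eqP; rewrite oner_eq0.
rewrite -SE in KE.
exists 'I_#|S|, (p \o enum_val); split=> [||i].
- by rewrite (hull_enum_val p i0S).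
- move=> n c pc; apply: (pspan n c) => i.
  apply: (@hull_dot_eq _ S p); first by rewrite SE; exact: mem_hull.
  by move=> j jS; rewrite -(pc (enum_rank_in i0S j))/= enum_rankK_in.
rewrite /=; move: (enum_val i) (enum_valP i) => {}i iS.
have [n0 sep0] := separation (Smin i iS).
(* The separating vector can be zero only if [p i] is the sole generator, and then any nonzero
   vector serves. *)
have [n nn0 sep] : exists2 n, n != 0 &
    forall j, j \in S :\ i -> dot (p j) n < dot (p i) n.
  have [n00|] := eqVneq n0 0; last by exists n0.
  by exists e0 => // j /sep0; rewrite n00 !dot0r ltxx.
have le_i j : j \in S -> dot (p j) n <= dot (p i) n.
  by move=> jS; have [->//|ji] := eqVneq j i; rewrite ltW// sep// !inE ji.
have Ki : K (p i) by rewrite KE; exact: mem_hull.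
exists n, (dot (p i) n); split.
  split=> //; last by exists (p i).
  by move=> x; rewrite KE => xS; exact: hull_dot_le xS le_i.
apply/seteqP; split=> [_ ->//|x []]; rewrite KE => -[l [l0 l1 ->]] /= xi.
have l_eq0 j : j \in S :\ i -> l j = 0.
  move=> jSi; have jS : j \in S by case/setD1P: jSi.
  have [//|ji] := comb_support l0 l1 le_i xi jS.
  by have := sep j jSi; rewrite ji ltxx.
move: l1; rewrite !(big_setD1 i iS)/= big1// addr0 => ->.
by rewrite scale1r big1 ?addr0// => j /l_eq0 ->; rewrite scale0r.
Qed.

End Hull.

(** * Facets, distances and normals *)

Lemma enormZ (R : realType) (d : nat) a (x : 'rV[R]_d) :
  enorm (a *: x) = `|a| * enorm x.
Proof.
by rewrite /enorm dotZl dotZr mulrA -expr2 sqrtrM ?sqr_ge0// sqrtr_sqr.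
Qed.

Lemma det_le (R : realType) (d : nat) (A : 'M[R]_d) (B : R) :
  (forall i j, `|A i j| <= B) -> `|\det A| <= d`!%:R * B ^+ d.
Proof.
move=> AB; rewrite /determinant; apply: le_trans (ler_norm_sum _ _ _) _.
rewrite -card_Sn -sum1_card natr_sum mulr_suml; apply: ler_sum => s _.
rewrite mul1r normrM normr_sign mul1r normr_prod.
rewrite -[in leRHS](card_ord d) -prodr_const; apply: ler_prod => i _.
by rewrite normr_ge0 AB.
Qed.

Section Facets.
Context {R : realType} {d : nat} (I : finType) (p : I -> 'rV[R]_d).
Variable K : set 'rV[R]_d.
Hypotheses (d0 : (0 < d)%N) (KE : K = hull [set: I] p)
  (pspan : affinely_spanning p) (pv : forall i, vertices K (p i)).
Local Notation normal := (outward_normal K).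
Implicit Types (f : set 'rV[R]_d) (x y b : 'rV[R]_d).

Lemma generator_mem i : K (p i).
Proof. by rewrite KE; exact: mem_hull. Qed.

Lemma generator_exists : inhabited I.
Proof.
apply: contrapT => nI; pose e0 : 'rV[R]_d := delta_mx ord0 (Ordinal d0).
have e00 : e0 = 0 by apply: (pspan (c := 0)) => i; case: nI.
by have /rowP/(_ (Ordinal d0)) /eqP := e00; rewrite !mxE !eqxx oner_eq0.
Qed.

Lemma face_sub f : face K f -> f `<=` K.
Proof. by move=> [n [c [_ ->]]] x []. Qed.

Lemma facet_sub f : facets K f -> f `<=` K.
Proof. by move=> [/face_sub]. Qed.

(** Any point of the face is a combination of generators, and those with nonzero coefficient lie on
    the supporting hyperplane. *)
Lemma face_vertex f : face K f -> exists i, f (p i).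
Proof.
move=> [n [c [[_ Kc [x [Kx xc]]] ->]]].
move: Kx xc; rewrite KE => -[l [l0 l1 ->]] xc.
have [i li] : exists i, l i != 0.
  apply: contrapT => /forallNP li; move/eqP: l1; rewrite big1 1?eq_sym ?oner_eq0//.
  by move=> i _; apply/eqP/negPn/negP/li.
exists i; rewrite -KE; split; first exact: generator_mem.
have [|/eqP|//] := comb_support l0 l1 _ xc (finset.in_setT i).
  by move=> j _; apply: Kc; exact: generator_mem.
by rewrite (negPf li).
Qed.

Lemma outward_normalP f : facets K f -> is_unit_outward_normal K f (normal f).
Proof.
move=> [[n [c [[n0 Kc _] ->]]] _]; apply: xgetPex; exists ((enorm n)^-1 *: n).
have en0 : 0 < enorm n.
  by rewrite lt_def enorm_ge0 andbT -sqrf_eq0 enorm_sqr gt_eqF// dot_gt0.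
split; first by rewrite enormZ gtr0_norm ?invr_gt0// mulVf// gt_eqF.
move=> y x [_ yc] Kx; rewrite !dotZr ler_pM2l ?invr_gt0//.
by rewrite yc; exact: Kc.
Qed.

Lemma dot_facet f x y : facets K f -> f x -> f y ->
  dot x (normal f) = dot y (normal f).
Proof.
move=> Kf fx fy; have [_ nP] := outward_normalP Kf.
by apply/eqP; rewrite eq_le !nP//; exact: (facet_sub Kf).
Qed.

(** The [xget] in [facet_dist] returns a genuine vertex of [f], since [f] contains a generator, and
    the normal is constant on [f]; any base point in [f] thus gives the same value. *)
Lemma facet_distE f x y : facets K f -> f y ->
  facet_dist K f x = dot (y - x) (normal f).
Proof.
move=> Kf fy; rewrite /facet_dist !dotBl; congr (_ - _); apply: dot_facet => //.
have [i fi] := face_vertex Kf.1.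
by have [] : vertices_of K f (xget 0 (vertices_of K f)) by apply: xgetPex; exists (p i).
Qed.

Lemma facet_dist_ge0 f x : facets K f -> K x -> 0 <= facet_dist K f x.
Proof.
move=> Kf Kx; have [i fi] := face_vertex Kf.1.
rewrite (facet_distE _ Kf fi) dotBl subr_ge0.
by have [_ nP] := outward_normalP Kf; exact: nP.
Qed.

Lemma facet_dist_eq0 f x : facets K f -> f x -> facet_dist K f x = 0.
Proof. by move=> Kf fx; rewrite (facet_distE _ Kf fx) subrr dot0l. Qed.

Lemma facet_dist_comb f l : facets K f -> \sum_(i in [set: I]%SET) l i = 1 ->
  facet_dist K f (\sum_(i in [set: I]%SET) l i *: p i) =
  \sum_(i in [set: I]%SET) l i * facet_dist K f (p i).
Proof.
move=> Kf l1; have [j fj] := face_vertex Kf.1.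
rewrite (facet_distE _ Kf fj) dotBl sub_dot_comb//.
by apply: eq_bigr => i _; rewrite (facet_distE _ Kf fj) dotBl.
Qed.

Lemma facet_dist_affine f x y t :
  facet_dist K f (x + t *: y) = facet_dist K f x - t * dot y (normal f).
Proof. by rewrite /facet_dist opprD addrA dotBl dotZl. Qed.

Lemma facet_of_direction i0 n :
  (forall i, dot (p i - p i0) n <= 0) -> n != 0 ->
  (\dim (tight_span (fun i => p i - p i0) n)).+1 = d ->
  facets K (K `&` hyperplane n (dot (p i0) n)).
Proof.
move=> pn n0; set a := fun i => p i - p i0; set U := tight_span a n => dU.
have Uorth u : u \in U -> dot u n = 0 by apply: tight_span_orth.
have Kn x : K x -> dot x n <= dot (p i0) n.
  rewrite KE => /hull_dot_le; apply => i _.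
  by have := pn i; rewrite dotBl subr_le0.
split.
  exists n, (dot (p i0) n); split => //; split=> //.
  by exists (p i0); split=> //; exact: generator_mem.
exists (\dim U) => //; exists (p i0), U; split=> //.
  by split=> //; exact: generator_mem.
apply/seteqP; split=> x.
  move=> [m [c [q [qf c1 ->]]]] /=; apply: (@mem_hyperplane _ _ U n) => //.
  rewrite -[p i0]scale1r -c1 scaler_suml -sumrB dot_suml big1// => i _.
  by rewrite -scalerBr dotZl dotBl (qf i).2 subrr mulr0.
move=> /= /(@coord_span _ _ _ (in_tuple _)).
set X := [seq a i | i <- enum I & dot (a i) n == 0] => xE.
(* A linear combination of tight edge vectors becomes an affine combination of points of the face
   once [p i0] takes the remaining weight. *)
pose q (j : 'I_(size X).+1) := if unlift ord0 j is Some i then X`_i + p i0 else p i0.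
pose c0 := coord (in_tuple X)^~ (x - p i0).
pose c (j : 'I_(size X).+1) := if unlift ord0 j is Some i then c0 i else 1 - \sum_i c0 i.
exists (size X).+1, c, q; split.
- move=> j; rewrite /q; case: unliftP => [i|] _; last first.
    by split=> //; exact: generator_mem.
  have /mapP[k] := mem_nth 0 (ltn_ord i).
  rewrite mem_filter => /andP[/eqP + _] ->; rewrite subrK => /eqP.
  by rewrite dotBl subr_eq0 => /eqP ?; split=> //; exact: generator_mem.
- rewrite big_ord_recl /c unlift_none; under [X in _ + X]eq_bigr do rewrite liftK.
  by rewrite subrK.
rewrite big_ord_recl /c /q unlift_none; under [X in _ + X]eq_bigr do rewrite liftK scalerDr.
rewrite big_split/= -scaler_suml addrCA -scalerDl subrK scale1r.
by rewrite -[LHS](subrK (p i0)); congr (_ + _).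
Qed.

(** [K] is the intersection of its facet half-spaces. A separating functional is maximal at some
    [p i0]; rotating it there by [facet_direction] makes it expose a facet while still separating
    [b]. *)
Lemma separating_facet b : ~ K b -> exists2 f, facets K f & facet_dist K f b < 0.
Proof.
rewrite {1}KE => /separation[n0 sep0]; have [k] := generator_exists.
have [i0 _ i0max] := @arg_maxP _ _ _ k predT (fun i => dot (p i) n0) isT.
pose a i := p i - p i0.
have a_span n : (forall i, dot (a i) n = 0) -> n = 0.
  move=> an; apply: (pspan (c := dot (p i0) n)) => i.
  by apply/eqP; rewrite -subr_eq0 -dotBl an.
have [||n [an bn dn]] := @facet_direction _ _ _ a (b - p i0).
- exact: a_span.
- exists n0; first by move=> i; rewrite dotBl subr_le0; exact: i0max.
  by rewrite dotBl subr_gt0 sep0.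
have nn0 : n != 0 by apply: contraTneq bn => ->; rewrite dot0r ltxx.
have Kf := facet_of_direction an nn0 dn.
set f := K `&` _ in Kf; exists f => //.
have fi0 : f (p i0) by split=> //; exact: generator_mem.
have [m1 mP] := outward_normalP Kf; set m := normal f in m1 mP.
rewrite (facet_distE _ Kf fi0) -/m -opprB dotNl oppr_lt0.
pose t := dot m n / dot n n; have nn := dot_gt0 nn0.
(* The component of [m] orthogonal to [n] lies in the tight span, which has codimension one, and [m]
   vanishes on that span because it is constant on [f]. *)
have mE : m = t *: n.
  apply/eqP; rewrite -subr_eq0; apply/eqP/dot_eq0.
  have rn : dot (m - t *: n) n = 0 by rewrite dotBl dotZl /t divfK ?gt_eqF// subrr.
  rewrite dotBr dotZr rn mulr0 subr0.
  apply: (@tight_span_orth _ _ _ a n) => [i ai|].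
    rewrite dotBl; apply/eqP; rewrite subr_eq0; apply/eqP/dot_facet => //.
    split; first exact: generator_mem.
    by apply/eqP; rewrite -subr_eq0 -dotBl; apply/eqP.
  apply: (mem_hyperplane nn0) => // u; exact: tight_span_orth (fun _ => id).
have [i ai] : exists i, dot (a i) n < 0.
  apply: contrapT => /forallNP ai; case/eqP: nn0; apply: a_span => i.
  by apply/eqP; rewrite eq_le an leNgt; apply/negP/ai.
have t0 : 0 <= t.
  have := mP _ _ fi0 (generator_mem i).
  by rewrite -subr_le0 -dotBl mE dotZr nmulr_lle0.
have tn0 : t != 0.
  by apply: contra_eq_neq m1 => t00; rewrite mE t00 enormZ normr0 mul0r eq_sym oner_eq0.
by rewrite mE dotZr mulr_gt0// lt_def tn0.
Qed.

(** A crude uniform bound, showing that the set in [diameter] is bounded above and its [sup]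
    meaningful. *)
Lemma dot_generator_le x n : K x -> enorm n = 1 -> dot x n <= \sum_k enorm (p k).
Proof.
move=> + n1; rewrite KE => /hull_dot_le; apply=> i _.
apply: le_trans (ler_norm _) (le_trans (dot_unit_le _ n1) _).
by rewrite (bigD1 i)//= lerDl sumr_ge0// => j _; exact: enorm_ge0.
Qed.

Lemma enorm_le_diameter x y : K x -> K y -> enorm (x - y) <= diameter K.
Proof.
move=> Kx Ky; apply: ub_le_sup; last by exists x => //; exists y.
exists (\sum_k enorm (p k) + \sum_k enorm (p k)) => _ [u Ku [w Kw <-]].
have [->|uw] := eqVneq (enorm (u - w)) 0.
  by rewrite addr_ge0// sumr_ge0// => j _; exact: enorm_ge0.
pose n := (enorm (u - w))^-1 *: (u - w).
have n1 : enorm n = 1 by rewrite enormZ ger0_norm ?invr_ge0 ?enorm_ge0// mulVf.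
have -> : enorm (u - w) = dot u n + dot w (- n).
  rewrite dotNr -dotBl dotZr -enorm_sqr expr2; field; exact: uw.
by rewrite lerD// dot_generator_le// -scaleN1r enormZ n1 normrN1 mul1r.
Qed.

Lemma diameter_gt0 : 0 < diameter K.
Proof.
have [i0] := generator_exists.
have [i pi] : exists i, p i - p i0 != 0.
  apply: contrapT => /forallNP pi.
  pose e0 : 'rV[R]_d := delta_mx ord0 (Ordinal d0).
  have e00 : e0 = 0.
    apply: (pspan (c := dot (p i0) e0)) => i; congr (dot _ _).
    by apply/eqP; rewrite -subr_eq0; apply/negPn/negP/pi.
  by have /rowP/(_ (Ordinal d0)) /eqP := e00; rewrite !mxE !eqxx oner_eq0.
apply: lt_le_trans (enorm_le_diameter (generator_mem i) (generator_mem i0)).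
by rewrite lt_def enorm_ge0 andbT -sqrf_eq0 enorm_sqr gt_eqF// dot_gt0.
Qed.

Lemma facet_dist_le_diameter f x : facets K f -> K x ->
  facet_dist K f x <= diameter K.
Proof.
move=> Kf Kx; have [i fi] := face_vertex Kf.1.
rewrite (facet_distE _ Kf fi); have [n1 _] := outward_normalP Kf.
apply: le_trans (ler_norm _) (le_trans (dot_unit_le _ n1) _).
by apply: enorm_le_diameter => //; exact: generator_mem.
Qed.

Lemma hstar_le f v : facets K f -> vertices K v -> ~ f v -> hstar K <= facet_dist K f v.
Proof.
move=> Kf Kv fv; apply: ge_inf; last by exists f, v; split=> //; split=> // -[].
exists 0 => _ [g [w [Kg [Kw _] ->]]]; apply: facet_dist_ge0 => //.
exact: (face_sub Kw).
Qed.

Lemma normal_mx_le v i j : (facets_at K v #= `I_d)%card -> `|normal_mx K v i j| <= 1.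
Proof.
move=> cv; rewrite mxE; set f := nth _ _ _.
have fin : finite_set (facets_at K v) by exists d.
have [Kf _] : facets_at K v f.
  have : f \in fset_set (facets_at K v).
    by apply: mem_nth; rewrite (card_fset_set cv).
  by rewrite in_fset_set// inE.
by have [<- _] := outward_normalP Kf; exact: coord_le_enorm.
Qed.

Lemma det_normal_mx_le v : (facets_at K v #= `I_d)%card ->
  `|\det (normal_mx K v)| <= d`!%:R.
Proof.
move=> cv; have := @det_le _ _ (normal_mx K v) 1.
by rewrite expr1n mulr1; apply => i j; exact: normal_mx_le.
Qed.

(** * The tangent cone at a vertex and the determinant of its facet normals *)

Section Vertex.
Variables (h : R) (v : 'rV[R]_d).
Hypotheses (h0 : 0 < h)
  (hdist : forall f u, facets K f -> vertices K u -> ~ f u -> h <= facet_dist K f u)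
  (Kv : vertices K v) (cv : (facets_at K v #= `I_d)%card).
Let F (j : 'I_d) := nth set0 (fset_set (facets_at K v)) j.

Let finFv : finite_set (facets_at K v).
Proof. by exists d. Qed.

Let FP j : facets K (F j) /\ F j v.
Proof.
have : F j \in fset_set (facets_at K v).
  by apply: mem_nth; rewrite (card_fset_set cv).
by rewrite in_fset_set// inE.
Qed.

Let F_surj f : facets K f -> f v -> exists j, f = F j.
Proof.
move=> Kf fv; have : f \in fset_set (facets_at K v) by rewrite in_fset_set// inE.
move=> fF; have := fF; rewrite -index_mem (card_fset_set cv) => fd.
by exists (Ordinal fd); rewrite /F nth_index.
Qed.

Lemma tangent_cone y : (forall j, dot y (normal (F j)) <= 0) ->
  exists2 e, 0 < e & K (v + e *: y).
Proof.
move=> yF; have ye := enorm_ge0 y; have y1 : 0 < 1 + enorm y by rewrite ltr_wpDr.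
(* The move is shorter than [h], hence crosses no facet away from [v]; adding 1 covers [y = 0]. *)
exists (h / (1 + enorm y)); first by rewrite divr_gt0.
apply: contrapT => /(separating_facet)[f Kf].
rewrite facet_dist_affine; apply/negP; rewrite -leNgt subr_ge0.
have [fv|fv] := pselect (f v).
  have [j ->] := F_surj Kf fv.
  rewrite (facet_dist_eq0 (FP j).1 (FP j).2).
  by rewrite mulr_ge0_le0// divr_ge0 ?ltW.
apply: le_trans (hdist Kf Kv fv).
have [n1 _] := outward_normalP Kf.
have := le_trans (ler_norm _) (dot_unit_le y n1) => yn.
rewrite -mulrA ler_piMr ?(ltW h0)// mulrC ler_pdivrMr// mul1r.
by rewrite (le_trans yn)// lerDr.
Qed.

Let mul_normal_mx y j : (y *m normal_mx K v) ord0 j = dot y (normal (F j)).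
Proof. by rewrite !mxE; apply: eq_bigr => k _; rewrite mxE. Qed.

(** A vector orthogonal to all the normals at [v] is tangent with both signs, so it gives a segment
    of [K] around [v]. The functional exposing [v] is then constant along that segment, which must
    be a point. *)
Lemma normal_mx_unit : normal_mx K v \in unitmx.
Proof.
rewrite -row_free_unit; apply: inj_row_free => y yM.
have yF j : dot y (normal (F j)) = 0 by rewrite -mul_normal_mx yM mxE.
have [n [c [[n0 Kc _] vE]]] := Kv.
have vc : dot v n = c by have : [set v] v by []; rewrite vE => -[].
have [e e0 Ke] : exists2 e, 0 < e & K (v + e *: y).
  by apply: tangent_cone => j; rewrite yF.
have [e' e'0 Ke'] : exists2 e, 0 < e & K (v + e *: - y).
  by apply: tangent_cone => j; rewrite dotNl yF oppr0.
have yn : dot y n = 0.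
  have := Kc _ Ke; have := Kc _ Ke'; rewrite /= !dotDl !dotZl dotNl vc.
  rewrite !gerDl pmulr_rle0// pmulr_rle0// oppr_le0 => ? ?.
  by apply/eqP; rewrite eq_le; apply/andP.
have : [set v] (v + e *: y).
  by rewrite vE; split=> //=; rewrite /hyperplane/= dotDl dotZl yn mulr0 addr0.
move=> /= /eqP; rewrite -subr_eq0 addrAC subrr add0r scaler_eq0 gt_eqF//=.
by move/eqP.
Qed.

(* [p k] is on the edge of [K] that leaves [v] opposite to the [i]-th facet. *)
Lemma neighbour_vertex i : exists k,
  (forall j, j != i -> facet_dist K (F j) (p k) = 0) /\ h <= facet_dist K (F i) (p k).
Proof.
(* The edge direction: it has product -1 with the [i]-th normal and 0 with the others. *)
pose y := - row i (invmx (normal_mx K v)).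
have yF j : dot y (normal (F j)) = - (i == j)%:R.
  rewrite -mul_normal_mx /y mulNmx -row_mul mulVmx ?normal_mx_unit//.
  by rewrite !mxE.
have [e e0 Ke] : exists2 e, 0 < e & K (v + e *: y).
  by apply: tangent_cone => j; rewrite yF oppr_le0 ler0n.
have distF j : facet_dist K (F j) (v + e *: y) = e * (i == j)%:R.
  rewrite facet_dist_affine yF mulrN opprK.
  by rewrite (facet_dist_eq0 (FP j).1 (FP j).2) add0r.
move: Ke; rewrite {1}KE => -[l [l0 l1 vl]].
have dist_ge0 j k : 0 <= facet_dist K (F j) (p k).
  by apply: (facet_dist_ge0 (FP j).1); exact: generator_mem.
have sumE j : \sum_(k in [set: I]%SET) l k * facet_dist K (F j) (p k) = e * (i == j)%:R.
  by rewrite -(facet_dist_comb (FP j).1 l1) -vl distF.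
(* The point on the edge averages the generators. One of positive weight is off [F i], and it lies
   on the other facets since their averaged distances vanish. *)
have [k lk] : exists k, 0 < l k * facet_dist K (F i) (p k).
  apply: contrapT => /forallNP lk; have := sumE i; rewrite eqxx mulr1 => eE.
  move: e0; rewrite -eE ltNge sumr_le0// => k _.
  by rewrite leNgt; apply/negP/lk.
have lk0 : 0 < l k.
  by rewrite lt_def l0 andbT; apply: contraTneq lk => ->; rewrite mul0r ltxx.
exists k; split=> [j ji|].
  have /eqP := sumE j; rewrite eq_sym in ji; rewrite (negPf ji) mulr0.
  rewrite psumr_eq0 => [/allP/(_ k (mem_index_enum _))|k' _]; last exact: mulr_ge0.
  by rewrite inE mulf_eq0 gt_eqF//= => /eqP.
apply: hdist (FP i).1 (pv k) _ => Fk.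
by move: lk; rewrite (facet_dist_eq0 (FP i).1 Fk) mulr0 ltxx.
Qed.

Lemma det_normal_mx_ge :
  h ^+ d <= d`!%:R * diameter K ^+ d * `|\det (normal_mx K v)|.
Proof.
have [u uP] := choice neighbour_vertex.
(* With these rows, entry [(i, j)] of the product with the normals is the distance from [p (u i)] to
   [F j]. *)
pose U := \matrix_(i < d, k < d) (v - p (u i)) ord0 k.
have UM : U *m normal_mx K v = diag_mx (\row_i facet_dist K (F i) (p (u i))).
  apply/matrixP => i j; rewrite !mxE.
  transitivity (facet_dist K (F j) (p (u i))).
    rewrite (facet_distE _ (FP j).1 (FP j).2).
    by apply: eq_bigr => k _; rewrite !mxE.
  have [->|ij] := eqVneq i j; first by rewrite mulr1n.
  by rewrite mulr0n (uP i).1// eq_sym.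
have := congr1 (fun A => `|\det A|) UM.
rewrite det_mulmx normrM det_diag => UME.
have -> : h ^+ d = \prod_(i < d) h by rewrite prodr_const card_ord.
apply: (@le_trans _ _ (`|\det U| * `|\det (normal_mx K v)|)).
  rewrite UME normr_prod; apply: ler_prod => i _; rewrite ltW//= mxE.
  exact: le_trans (uP i).2 (ler_norm _).
rewrite ler_wpM2r//; apply: det_le => i k; rewrite mxE.
apply: le_trans (coord_le_enorm _ _) _; apply: enorm_le_diameter.
  exact: (face_sub Kv).
exact: generator_mem.
Qed.

End Vertex.

(* Averaging [facet_dist K f] over a convex combination of the generators that
   equals [x]: the facets close to [x] cannot miss all the generators. *)
Lemma near_vertex (h : R) N x : 0 < h ->
  (forall f u, facets K f -> vertices K u -> ~ f u -> h <= facet_dist K f u) ->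
  (facets K #<= `I_N)%card -> K x ->
  exists k, forall f, facets K f -> ~ f (p k) -> h / N.+1%:R <= facet_dist K f x.
Proof.
move=> h0 hdist cN; rewrite {1}KE => -[l [l0 l1 xE]].
apply: contrapT => /forallNP H.
have fin : finite_set (facets K) by apply/finite_set_leP; exists N.
pose small f := facet_dist K f x < h / N.+1%:R.
have : h <= \sum_(f <- fset_set (facets K) | small f) facet_dist K f x.
  rewrite [leRHS](_ : _ = \sum_(f <- fset_set (facets K) | small f)
      \sum_(k in [set: I]%SET) l k * facet_dist K f (p k)); last first.
    rewrite [LHS]big_seq_cond [RHS]big_seq_cond; apply: eq_bigr => f /andP[].
    by rewrite in_fset_set// inE => Kf _; rewrite xE (facet_dist_comb Kf l1).
  rewrite exchange_big/= -[leLHS]mul1r -l1 mulr_suml; apply: ler_sum => k _.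
  have /existsNP[f /not_implyP[Kf /not_implyP[fk /negP]]] := H k.
  rewrite -ltNge => fx.
  have ge0 g : g \in fset_set (facets K) -> 0 <= l k * facet_dist K g (p k).
    rewrite in_fset_set// inE => Kg.
    by rewrite mulr_ge0// facet_dist_ge0//; exact: generator_mem.
  have fK : f \in fset_set (facets K) by rewrite in_fset_set// inE.
  rewrite (big_rem f)//= /small fx.
  apply: (@le_trans _ _ (l k * facet_dist K f (p k))).
    by rewrite ler_wpM2l// hdist.
  rewrite lerDl big_seq_cond sumr_ge0// => g /andP[/mem_rem gK _].
  exact: ge0.
(* At most [N] facets contribute, each at most [h / N.+1%:R], so the sum stays strictly below
   [h]. *)
apply/negP; rewrite -ltNge.
apply: (@le_lt_trans _ _ (\sum_(f <- fset_set (facets K)) h / N.+1%:R)).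
  rewrite big_mkcond/=; apply: ler_sum => f _; case: ifP => [/ltW//|_].
  by rewrite divr_ge0// ltW.
rewrite big_const_seq count_predT iter_addr_0.
have cardN : (#|` fset_set (facets K)| <= N)%N by exact: geq_card_fset_set.
rewrite -[ltLHS]mulr_natr mulrAC ltr_pdivrMr// ltr_pM2l// ltr_nat ltnS.
exact: cardN.
Qed.

End Facets.

(** * Bounds on iterated partial derivatives *)

Section DerivativeBounds.
Context {R : realType} {d : nat}.
Local Notation E := 'rV[R]_d.
Variables (O K : set E) (h : R).
Hypotheses (Oopen : open O) (KO : K `<=` O) (h0 : 0 < h).
Implicit Types (F G : E -> R) (C : R) (n r : nat).

(* [G] has at least [n] derivatives on [O], and on [K] those of order [k <= n]
   are bounded by [C * h ^- (r + k)]. *)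
Fixpoint derivs_le C n r G : Prop :=
  (forall x, K x -> `|G x| <= C * h ^- r) /\
  if n is n'.+1 then forall i, (forall x, O x -> derivable G x (delta_mx ord0 i)) /\
    derivs_le C n' r.+1 (partial i G)
  else True.

Lemma derivs_le_bound C n r G x : derivs_le C n r G -> K x -> `|G x| <= C * h ^- r.
Proof. by case: n => [|n] [+ _] Kx; apply. Qed.

(** The reason for carrying an open [O] around [K]: agreement on [O] passes to partial derivatives,
    even at boundary points of [K]. *)
Lemma derivs_le_eq C n r F G : {in O, F =1 G} -> derivs_le C n r F -> derivs_le C n r G.
Proof.
elim: n r F G => [|n IH] r F G FG /= [F0 Fn].
  by split=> // x Kx; rewrite -FG ?F0// inE; exact: KO.
split=> [x Kx|i]; first by rewrite -FG ?F0// inE; exact: KO.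
have nearFG x : O x -> \near x, F x = G x.
  move=> Ox; apply: filterS (open_nbhs_nbhs (conj Oopen Ox)) => y Oy.
  by apply: FG; rewrite inE.
have [dF Fi] := Fn i; split=> [x Ox|].
  by apply: near_eq_derivable (dF x Ox); exact: nearFG.
apply: IH Fi => x; rewrite inE => Ox; apply: near_eq_derive; exact: nearFG.
Qed.

Lemma derivs_leW C C' n r G : C <= C' -> derivs_le C n r G -> derivs_le C' n r G.
Proof.
move=> CC'; elim: n r G => [|n IH] r G /= [G0 Gn].
  split=> // x Kx; apply: le_trans (G0 x Kx) _.
  by rewrite ler_wpM2r// invr_ge0 exprn_ge0// ltW.
split=> [x Kx|i].
  by apply: le_trans (G0 x Kx) _; rewrite ler_wpM2r// invr_ge0 exprn_ge0// ltW.
by have [dG Gi] := Gn i; split=> //; exact: IH.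
Qed.

Lemma derivs_le_pred C n r G : derivs_le C n.+1 r G -> derivs_le C n r G.
Proof.
elim: n r G => [|n IH] r G [G0 Gn]; first by split.
by split=> // i; have [dG Gi] := Gn i; split=> //; exact: IH.
Qed.

Lemma derivs_le_cst C n r c : `|c| <= C * h ^- r -> derivs_le C n r (cst c).
Proof.
elim: n r c => [|n IH] r c cC; first by split.
split=> // i; split=> [x _|]; first exact: derivable_cst.
have -> : partial i (cst c : E -> R) = cst 0.
  by apply/funext => x; rewrite /partial derive_cst.
have C0 : 0 <= C.
  have := le_trans (normr_ge0 c) cC.
  by rewrite pmulr_lge0// invr_gt0 exprn_gt0.
by apply: IH; rewrite normr0 mulr_ge0// invr_ge0 exprn_ge0// ltW.
Qed.

Lemma derivs_leD C1 C2 n r F G : derivs_le C1 n r F -> derivs_le C2 n r G ->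
  derivs_le (C1 + C2) n r (F + G).
Proof.
elim: n r F G => [|n IH] r F G /= [F0 Fn] [G0 Gn].
  split=> // x Kx; rewrite mulrDl; apply: le_trans (ler_normD _ _) _.
  by rewrite lerD ?F0 ?G0.
split=> [x Kx|i].
  by rewrite mulrDl; apply: le_trans (ler_normD _ _) _; rewrite lerD ?F0 ?G0.
have [dF Fi] := Fn i; have [dG Gi] := Gn i; split=> [x Ox|].
  by apply: derivableD; [exact: dF | exact: dG].
apply: derivs_le_eq (IH _ _ _ Fi Gi) => x; rewrite inE => Ox.
by rewrite /partial deriveD//; [exact: dF | exact: dG].
Qed.

(** Each differentiation replaces a product by two products, whence the factor 2 per order. *)
Lemma derivs_leM C1 C2 n r1 r2 F G : derivs_le C1 n r1 F -> derivs_le C2 n r2 G ->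
  derivs_le (2 ^+ n * C1 * C2) n (r1 + r2) (F * G).
Proof.
have bound C1' C2' s1 s2 F' G' x : K x -> `|F' x| <= C1' * h ^- s1 ->
    `|G' x| <= C2' * h ^- s2 -> `|F' x * G' x| <= C1' * C2' * h ^- (s1 + s2).
  move=> Kx F'x G'x; rewrite normrM exprD invfM mulrACA.
  by apply: ler_pM.
elim: n r1 r2 F G=> [|n IH] r1 r2 F G [F0 Fn] [G0 Gn].
  by split=> // x Kx; rewrite expr0 mul1r; apply: bound; rewrite ?F0 ?G0.
split=> [x Kx|i].
  apply: le_trans (bound _ _ _ _ _ _ _ Kx (F0 x Kx) (G0 x Kx)) _.
  rewrite ler_wpM2r ?invr_ge0 ?exprn_ge0 ?(ltW h0)// -mulrA ler_peMl//.
    apply: mulr_ge0.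
      have := le_trans (normr_ge0 _) (F0 x Kx).
      by rewrite pmulr_lge0// invr_gt0 exprn_gt0.
    have := le_trans (normr_ge0 _) (G0 x Kx).
    by rewrite pmulr_lge0// invr_gt0 exprn_gt0.
  by rewrite exprn_ege1// ler1n.
have [dF Fi] := Fn i; have [dG Gi] := Gn i; split=> [x Ox|].
  by apply: derivableM; [exact: dF | exact: dG].
have Fl : derivs_le C1 n r1 F by apply: derivs_le_pred; split.
have Gl : derivs_le C2 n r2 G by apply: derivs_le_pred; split.
have FiG := IH _ _ _ _ Fi Gl; have := IH _ _ _ _ Fl Gi.
rewrite addSn in FiG; rewrite addnS => /derivs_leD/(_ FiG).
rewrite exprS -!mulrA mulr_natl mulr2n; apply: derivs_le_eq => x; rewrite inE => Ox.
rewrite /partial deriveM; [|exact: dF|exact: dG].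
by congr (_ + _); exact: mulrC.
Qed.

Lemma derivs_le_sum (J : eqType) (s : seq J) C n r (G : J -> E -> R) :
  (forall j, j \in s -> derivs_le C n r (G j)) ->
  derivs_le (C *+ size s) n r (fun x => \sum_(j <- s) G j x).
Proof.
elim: s => [|j s IH] Gs.
  have := @derivs_le_cst 0 n r 0; rewrite normr0 mul0r lexx => /(_ isT).
  by apply: derivs_le_eq => x _; rewrite big_nil.
have {}IH : derivs_le (C *+ size s) n r (fun x => \sum_(j <- s) G j x).
  by apply: IH => k ks; apply: Gs; rewrite inE ks orbT.
rewrite mulrS; apply: derivs_le_eq (derivs_leD (Gs j (mem_head _ _)) IH) => x _.
by rewrite big_cons.
Qed.

Lemma derivs_le_prod (J : eqType) (s : seq J) C n (G : J -> E -> R) :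
  (forall j, j \in s -> derivs_le C n 0 (G j)) ->
  derivs_le ((2 ^+ n * C) ^+ size s) n 0 (fun x => \prod_(j <- s) G j x).
Proof.
elim: s => [|j s IH] Gs.
  have := @derivs_le_cst 1 n 0 1; rewrite normr1 invr1 mulr1 lexx => /(_ isT).
  by apply: derivs_le_eq => x _; rewrite big_nil.
have {}IH : derivs_le ((2 ^+ n * C) ^+ size s) n 0 (fun x => \prod_(j <- s) G j x).
  by apply: IH => k ks; apply: Gs; rewrite inE ks orbT.
rewrite exprS; apply: derivs_le_eq (derivs_leM (Gs j (mem_head _ _)) IH) => x _.
by rewrite big_cons.
Qed.

(* The recursion follows [D (1 / G) = - D G * (1 / G) * (1 / G)]. *)
Fixpoint inv_bound C c n : R :=
  if n is n'.+1 then
    let C' := inv_bound C c n' in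
    c^-1 + 2 ^+ n' * (2 ^+ n' * (2 ^+ n' * 1 * C) * C') * C'
  else c^-1.

Lemma inv_bound_ge0 C c n : 0 <= C -> 0 < c -> 0 <= inv_bound C c n.
Proof.
move=> C0 c0; elim: n => [|n IH] /=; first by rewrite invr_ge0 ltW.
by rewrite addr_ge0 ?invr_ge0 ?(ltW c0)// !mulr_ge0// exprn_ge0.
Qed.

(** Non-vanishing on [O] gives differentiability there; the lower bound on [K] gives the
    estimates. *)
Lemma derivs_leV C c n G : 0 <= C -> 0 < c -> (forall x, O x -> G x != 0) ->
  (forall x, K x -> c <= G x) -> derivs_le C n 0 G ->
  derivs_le (inv_bound C c n) n 0 (fun x => (G x)^-1).
Proof.
move=> C0 c0 GO GK.
have G0 x : K x -> `|(G x)^-1| <= c^-1.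
  move=> Kx; have Gx := lt_le_trans c0 (GK x Kx).
  by rewrite gtr0_norm ?invr_gt0// lef_pV2// ?posrE// GK.
elim: n => [|n IH] Gn; first by split=> // x /G0; rewrite expr0 invr1 mulr1.
have {}IH := IH (derivs_le_pred Gn); have B0 := inv_bound_ge0 n C0 c0.
case: Gn => _ Gn; split=> [x Kx|i].
  rewrite expr0 invr1 mulr1; apply: le_trans (G0 x Kx) _.
  by rewrite /= lerDl !mulr_ge0// exprn_ge0.
have [dG Gi] := Gn i; split=> [x Ox|].
  by apply: derivableV; [exact: GO | exact: dG].
apply: (@derivs_leW (2 ^+ n * (2 ^+ n * (2 ^+ n * 1 * C) * inv_bound C c n) *
  inv_bound C c n)); first by rewrite /= lerDr invr_ge0 ltW.
have N1 : derivs_le 1 n 0 (cst (-1)).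
  by apply: derivs_le_cst; rewrite normrN1 expr0 invr1 mulr1.
have := derivs_leM (derivs_leM (derivs_leM N1 Gi) IH) IH.
rewrite add0n !addn0; apply: derivs_le_eq => x; rewrite inE => Ox.
rewrite /partial deriveV; [|exact: GO|exact: dG].
transitivity (-1 * 'D_(delta_mx ord0 i) G x * (G x)^-1 * (G x)^-1) => //.
transitivity (- (G x) ^- 2 * 'D_(delta_mx ord0 i) G x) => //.
by field; exact: GO.
Qed.

(** The first partial derivatives are the constants [k i], so all later ones vanish. *)
Lemma derivs_le_affine n G (k : 'I_d -> R) :
  (forall x, K x -> `|G x| <= 1) -> (forall i, `|k i| <= h^-1) ->
  (forall x t i, G (t *: delta_mx ord0 i + x) = G x + t * k i) ->
  derivs_le 1 n 0 G.
Proof.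
move=> G1 k1 GE.
have Gder x i : is_derive x (delta_mx ord0 i : E) G (k i).
  have cv : (fun t : R => t^-1 *: ((G \o shift x) (t *: (delta_mx ord0 i : E)) - G x))
      @ 0^' --> k i.
    apply: cvg_near_cst; near=> t.
    have t0 : t != 0 by near: t; exact: nbhs_dnbhs_neq.
    by rewrite /= GE addrAC subrr add0r /GRing.scale/= mulKf.
  apply: DeriveDef; last exact: cvg_lim cv.
  by apply/cvg_ex; exists (k i).
case: n => [|n]; first by split=> // x Kx; rewrite expr0 invr1 mulr1 G1.
split=> [x Kx|i]; first by rewrite expr0 invr1 mulr1 G1.
split=> [x _|]; first by have [] := Gder x i.
have -> : partial i G = cst (k i).
  by apply/funext => x; rewrite /partial; have [_ ->] := Gder x i.
by apply: derivs_le_cst; rewrite mul1r expr1.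
Unshelve. all: by end_near. Qed.

Lemma derivs_le_iter C n k r i G :
  derivs_le C (k + n) r G -> derivs_le C n (k + r) (iter k (partial i) G).
Proof.
elim: k r G => [//|k IH] r G [_ /(_ i)[_ /IH]].
by rewrite addnS iterSr.
Qed.

(** Coordinates are peeled off one by one, each consuming [alpha i] of the available orders. *)
Lemma derivs_le_mder C n (alpha : 'I_d -> nat) G :
  derivs_le C (mabs alpha + n) 0 G -> derivs_le C n (mabs alpha) (mder alpha G).
Proof.
rewrite /mder /mabs.
have -> : (\sum_(i < d) alpha i = \sum_(i <- enum 'I_d) alpha i)%N.
  by rewrite big_enum.
elim: (enum 'I_d) n => [|i s IH] n /=; first by rewrite big_nil.
rewrite big_cons -addnA => H; apply: derivs_le_iter; apply: IH.
by rewrite addnCA.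
Qed.

End DerivativeBounds.

(** * Scaled weights *)

Section Weights.
Context {R : realType} {d : nat}.
Local Notation E := 'rV[R]_d.
Implicit Types (K f : set E) (v x : E).

(** Dividing by the diameter brings each factor into the interval from 0 to 1 on [K], with slopes at
    most the inverse diameter. *)
Definition scaled_weight K v x : R :=
  `|\det (normal_mx K v)| *
  \prod_(f <- fset_set (facets K `\` facets_at K v)) (facet_dist K f x / diameter K).

Definition scaled_total K x : R :=
  \sum_(u <- fset_set (vertices K)) scaled_weight K u x.

Lemma facet_dist_continuous K f : continuous (facet_dist K f).
Proof.
rewrite /facet_dist /dot; apply: continuous_big => [|i _ x].
  exact: add_continuous.
apply: continuousM; last exact: cst_continuous.
rewrite (_ : (fun x : E => _) = cst ((xget 0 (vertices_of K f)) ord0 i) -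
    (fun y : E => y ord0 i)).
  by apply: continuousB; [exact: cst_continuous | exact: coord_continuous].
by apply/funext => y; rewrite !mxE.
Qed.

Lemma scaled_total_continuous K : continuous (scaled_total K).
Proof.
apply: continuous_big => [|v _ x]; first exact: add_continuous.
apply: (@continuousM _ _ (cst `|\det (normal_mx K v)|)
  (fun y => \prod_(f <- fset_set (facets K `\` facets_at K v))
              (facet_dist K f y / diameter K))).
  exact: cst_continuous.
move: x; apply: continuous_big => [|f _ x]; first exact: mul_continuous.
by apply: continuousM; [exact: facet_dist_continuous | exact: cst_continuous].
Qed.

Lemma card_facets_away K v : finite_set (facets K) -> (facets_at K v #= `I_d)%card ->
  #|` fset_set (facets K `\` facets_at K v)| = (#|` fset_set (facets K)| - d)%N.
Proof.
move=> finK cv; have fin : finite_set (facets_at K v) by exists d.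
rewrite fset_setD// cardfsDS ?(card_fset_set cv)//.
by rewrite -fset_set_sub// => f [].
Qed.

Lemma weight_scaled K v x : finite_set (facets K) -> (facets_at K v #= `I_d)%card ->
  diameter K != 0 ->
  weight K v x = diameter K ^+ (#|` fset_set (facets K)| - d) * scaled_weight K v x.
Proof.
move=> finK cv D0; rewrite /weight /scaled_weight mulrCA; congr (_ * _).
rewrite big_split/= big_const_seq count_predT iter_mulr_1.
rewrite -(card_facets_away finK cv).
by rewrite mulrCA exprVn mulfV ?mulr1// expf_neq0.
Qed.

(** By simplicity all weights have the same number of distance factors, so one common power of the
    diameter cancels in the quotient. *)
Lemma wachspress_scaled K v : finite_set (facets K) -> simple_polytope K ->
  finite_set (vertices K) -> vertices K v -> diameter K != 0 ->
  wachspress K v = scaled_weight K v * (fun x => (scaled_total K x)^-1).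
Proof.
move=> finF simple finV Kv D0; apply/funext => x; rewrite /wachspress.
have -> : total_weight K x =
    diameter K ^+ (#|` fset_set (facets K)| - d) * scaled_total K x.
  rewrite /total_weight mulr_sumr; apply: eq_big_seq => u.
  by rewrite in_fset_set// inE => Ku; rewrite weight_scaled//; exact: simple.
rewrite weight_scaled//; last exact: simple.
by rewrite -mulf_div divff ?mul1r// expf_neq0.
Qed.

(** * Bounds uniform over the class of polytopes *)

Section Bounds.
Variables (I : finType) (p : I -> E) (K : set E) (NF NV : nat) (c : R).
Hypotheses (d0 : (0 < d)%N) (KE : K = hull [set: I] p)
  (pspan : affinely_spanning p) (pv : forall i, vertices K (p i))
  (simple : simple_polytope K) (cF : (facets K #<= `I_NF)%card)
  (cV : (vertices K #<= `I_NV)%card) (c0 : 0 < c)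
  (hs : c * diameter K <= hstar K).
Local Notation D := (diameter K).

Let D0 : 0 < D.
Proof. exact: diameter_gt0 d0 KE pspan. Qed.

Let finF : finite_set (facets K).
Proof. by apply/finite_set_leP; exists NF. Qed.

Let finV : finite_set (vertices K).
Proof. by apply/finite_set_leP; exists NV. Qed.

Let card_away v : (#|` fset_set (facets K `\` facets_at K v)| <= NF)%N.
Proof.
apply: leq_trans (geq_card_fset_set cF); apply: fsubset_leq_card.
have fin : finite_set (facets K `\` facets_at K v) by apply: sub_finite_set finF => f [].
by rewrite -fset_set_sub// => f [].
Qed.

Definition weight_bound n : R := 2 ^+ n * d`!%:R * (2 ^+ n) ^+ NF.

Lemma scaled_weight_derivs O n v : open O -> K `<=` O -> vertices K v ->
  derivs_le O K D (weight_bound n) n 0 (scaled_weight K v).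
Proof.
move=> Oo KO Kv.
have dist_le f : f \in fset_set (facets K `\` facets_at K v) ->
    derivs_le O K D 1 n 0 (fun x => facet_dist K f x / D).
  rewrite in_fset_set; last by apply: sub_finite_set finF => g [].
  rewrite inE => -[Kf _].
  apply: (@derivs_le_affine _ _ O K D D0 n _ (fun i => - outward_normal K f ord0 i / D)).
  - move=> x Kx; rewrite ger0_norm ?divr_ge0 ?(ltW D0)// ?(facet_dist_ge0 KE pv)//.
    by rewrite ler_pdivrMr// mul1r (facet_dist_le_diameter KE pv).
  - move=> i; rewrite normrM normrN normfV (gtr0_norm D0) ler_piMl ?invr_ge0 ?(ltW D0)//.
    by have [<- _] := outward_normalP Kf; exact: coord_le_enorm.
  - move=> x t i; rewrite addrC facet_dist_affine dotC dot_deltar; field.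
    by rewrite gt_eqF.
have prod_le := derivs_le_prod Oo KO D0 dist_le.
have cst_le : derivs_le O K D d`!%:R n 0 (cst `|\det (normal_mx K v)|).
  apply: derivs_le_cst => //; rewrite expr0 invr1 mulr1 normr_id.
  exact: det_normal_mx_le (simple Kv).
have := derivs_leM Oo KO D0 cst_le prod_le; apply: derivs_leW => //.
rewrite mulr1 /weight_bound ler_wpM2l ?mulr_ge0 ?exprn_ge0//.
by rewrite ler_weXn2l// exprn_ege1// ler1n.
Qed.

Lemma scaled_total_derivs O n : open O -> K `<=` O ->
  derivs_le O K D (weight_bound n *+ NV) n 0 (scaled_total K).
Proof.
move=> Oo KO.
have wle v : v \in fset_set (vertices K) ->
    derivs_le O K D (weight_bound n) n 0 (scaled_weight K v).
  by rewrite in_fset_set// inE; exact: scaled_weight_derivs.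
have := derivs_le_sum Oo KO D0 wle; apply: derivs_leW => //.
by apply: ler_wpMn2l (geq_card_fset_set cV); rewrite !mulr_ge0// exprn_ge0.
Qed.

(** Determinant bound times distance bound at a vertex given by [near_vertex]. The minimum with 1
    allows the exponent to be raised from the actual number of factors to [NF]. *)
Definition total_lower_bound : R :=
  c ^+ d / d`!%:R * Num.min 1 (c / NF.+1%:R) ^+ NF.

Lemma total_lower_bound_gt0 : 0 < total_lower_bound.
Proof.
rewrite mulr_gt0// ?divr_gt0 ?exprn_gt0 ?ltr0n ?fact_gt0//.
by rewrite lt_min ltr01 divr_gt0.
Qed.

Lemma scaled_total_ge x : K x -> total_lower_bound <= scaled_total K x.
Proof.
move=> Kx; have h0 : 0 < c * D by rewrite mulr_gt0.
have hdist f u : facets K f -> vertices K u -> ~ f u -> c * D <= facet_dist K f u.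
  move=> Kf Ku fu; apply: (le_trans hs). exact: (hstar_le KE pv Kf Ku fu).
have [k kP] := near_vertex KE pv h0 hdist cF Kx.
have ge0 u : 0 <= scaled_weight K u x.
  rewrite mulr_ge0// big_seq prodr_ge0// => f.
  rewrite in_fset_set; last by apply: sub_finite_set finF => g [].
  by rewrite inE => -[Kf _]; rewrite divr_ge0 ?(ltW D0)// (facet_dist_ge0 KE pv).
have kV : p k \in fset_set (vertices K) by rewrite in_fset_set// inE; exact: pv.
rewrite /scaled_total (big_rem (p k))//=.
apply: (@le_trans _ _ (scaled_weight K (p k) x)); last first.
  by rewrite lerDl sumr_ge0.
have det_ge : c ^+ d / d`!%:R <= `|\det (normal_mx K (p k))|.
  have := det_normal_mx_ge d0 KE pspan pv h0 hdist (pv k) (simple (pv k)).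
  rewrite exprMn mulrAC ler_pM2r ?exprn_gt0// => cd.
  by rewrite ler_pdivrMr ?ltr0n ?fact_gt0// mulrC.
set a := Num.min 1 (c / NF.+1%:R).
have a0 : 0 <= a by rewrite le_min ler01 divr_ge0// ltW.
apply: ler_pM => //.
- by rewrite divr_ge0// exprn_ge0// ltW.
- by rewrite exprn_ge0.
apply: (@le_trans _ _ (a ^+ #|` fset_set (facets K `\` facets_at K (p k))|)).
  by apply: ler_wiXn2l => //; rewrite ge_min lexx.
rewrite -[X in X <= _]mulr1 -iter_mulr -(count_predT) -big_const_seq.
rewrite big_seq [leRHS]big_seq; apply: ler_prod => f.
rewrite in_fset_set; last by apply: sub_finite_set finF => g [].
rewrite inE => -[Kf fk]; rewrite a0/= ler_pdivlMr//.
have /(kP _ Kf) : ~ f (p k) by move=> fpk; apply: fk.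
apply: le_trans; rewrite mulrAC ler_pM2r//.
by rewrite ge_min lexx orbT.
Qed.

Definition wachspress_bound n : R :=
  2 ^+ n * weight_bound n *
  inv_bound (weight_bound n *+ NV) total_lower_bound n.

Lemma wachspress_derivs n v : vertices K v ->
  exists O, derivs_le O K D (wachspress_bound n) n 0 (wachspress K v).
Proof.
(* The natural domain of the quotient: open by continuity, and containing [K] by the lower bound. *)
move=> Kv; pose O := scaled_total K @^-1` [set t | t != 0].
have Oo : open O.
  by apply: open_comp => [x _|]; [exact: scaled_total_continuous | exact: open_neq].
have KO : K `<=` O.
  move=> x /scaled_total_ge; rewrite /O/= => /(lt_le_trans total_lower_bound_gt0).
  by move=> /gt_eqF ->.
exists O; rewrite wachspress_scaled ?gt_eqF//.
apply: (@derivs_leM _ _ O K D _ _ _ _ _ n 0 0) => //.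
  exact: scaled_weight_derivs.
apply: derivs_leV => //.
- by rewrite mulrn_wge0// !mulr_ge0// exprn_ge0.
- exact: total_lower_bound_gt0.
- exact: scaled_total_ge.
- exact: scaled_total_derivs.
Qed.

End Bounds.
End Weights.

Theorem theorem3p7 (R : realType) (d : nat) (hd : (1 <= d)%N)
    (alpha : 'I_d -> nat) (NF NV : nat) (hNF : (0 < NF)%N) (hNV : (0 < NV)%N)
    (Cstar : R) (hCstar : 0 < Cstar) :
  exists2 C : R, 0 < C &
    forall K : set 'rV[R]_d,
      polytope K -> simple_polytope K -> non_degenerate K ->
      (facets K #<= `I_NF)%card -> (vertices K #<= `I_NV)%card ->
      Cstar * diameter K <= hstar K ->
      forall v x : 'rV[R]_d, vertices K v -> K x ->
        `|mder alpha (wachspress K v) x| <= C * diameter K ^- mabs alpha.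
Proof.
pose B := @wachspress_bound R d NF NV Cstar (mabs alpha).
(* The constant is fixed before [K]; the absolute value and the added 1 make it positive whatever
   the sign of [B]. *)
exists (`|B| + 1) => [|K Kpoly simple _ cF cV hs v x Kv Kx].
  by rewrite ltr_wpDl.
have [I [p [KE pspan pv]]] := polytope_hull_vertices hd Kpoly.
have D0 := diameter_gt0 hd KE pspan.
have [ O OB] := wachspress_derivs hd KE pspan pv simple cF cV hCstar hs (mabs alpha) Kv.
have := @derivs_le_mder _ _ O K (diameter K) _ 0 alpha (wachspress K v).
rewrite addn0 => /(_ _ OB)/derivs_le_bound/(_ Kx) /le_trans; apply.
by rewrite ler_wpM2r ?invr_ge0 ?exprn_ge0 ?(ltW D0)// (le_trans (ler_norm _))// lerDl.
Qed.
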